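(* Let $d\ge 2$. If the unit sphere $S^{d-1}\subset\mathbb R^d$ is covered by a set of spherical segments, then the sum of their widths is at least $\pi$.
   Context: $S^{d-1}$ is the Euclidean unit sphere centered at the origin of $\mathbb R^d$, with its intrinsic (angular) metric, in which the distance between $u,v\in S^{d-1}$ is $\arccos\langle u,v\rangle$. A spherical segment of width $2\delta$ (with $\delta>0$) on $S^{d-1}$ is a closed $\delta$-neighborhood, in the intrinsic metric of the sphere, of an intersection $H\cap S^{d-1}$, where $H\subset\mathbb R^d$ is an affine hyperplane (not necessarily passing through the origin). *)

(* Defs.v *)
From HB Require Import structures.
From mathcomp Require Import all_boot all_order all_algebra.
From mathcomp Require Import all_classical all_reals all_analysis.

Set Implicit Arguments.
Unset Strict Implicit.
Unset Printing Implicit Defensive.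

Import Order.TTheory GRing.Theory Num.Theory.

Local Open Scope classical_set_scope.
Local Open Scope ring_scope.

Definition dotv (R : realType) (d : nat) (u v : 'rV[R]_d) : R :=
  \sum_(i < d) u 0 i * v 0 i.

(* The library norm on ['rV[R]_d] is the sup norm, hence an explicit one. *)
Definition euclidean_norm (R : realType) (d : nat) (u : 'rV[R]_d) : R :=
  Num.sqrt (dotv u u).

(* S^(d-1), as a subset of R^d. *)
Definition unit_sphere (R : realType) (d : nat) : set 'rV[R]_d :=
  [set u | euclidean_norm u = 1].
Arguments unit_sphere : clear implicits.

(* The intrinsic metric of the sphere; only meaningful for unit vectors. *)
Definition angular_dist (R : realType) (d : nat) (u v : 'rV[R]_d) : R :=
  acos (dotv u v).

(* Distance from u to A; extended-real valued, so that it is +oo (and not an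
   arbitrary real) when A is empty. *)
Definition angular_dist_set (R : realType) (d : nat)
    (A : set 'rV[R]_d) (u : 'rV[R]_d) : \bar R :=
  ereal_inf [set (angular_dist u v)%:E | v in A].

Definition closed_sphere_nbhd (R : realType) (d : nat)
    (delta : R) (A : set 'rV[R]_d) : set 'rV[R]_d :=
  [set u | unit_sphere R d u /\ (angular_dist_set A u <= delta%:E)%E].

Definition affine_hyperplane (R : realType) (d : nat)
    (H : set 'rV[R]_d) : Prop :=
  exists (n : 'rV[R]_d) (c : R), n != 0 /\ H = [set x | dotv n x = c].

(* A relation rather than a width function: the same point set may arise from
   several pairs (H, delta), e.g. a spherical cap or the whole sphere. *)
Definition spherical_segment (R : realType) (d : nat)
    (w : R) (Z : set 'rV[R]_d) : Prop :=
  exists (H : set 'rV[R]_d) (delta : R),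
    [/\ 0 < delta, w = 2 * delta, affine_hyperplane H &
        Z = closed_sphere_nbhd delta (H `&` unit_sphere R d)].

(* Main.v *)
Require Import Defs.
From mathcomp Require Import all_boot all_order all_algebra.
From mathcomp Require Import all_classical all_reals all_analysis.
From mathcomp Require Import finmap ring lra.

(** Why the theorem holds.

The core is an estimate about one trigonometric polynomial [T] of degree [n]:
a zero of [T] is at distance at least [pi / (2 * n)] from a point where [|T|]
is maximal ([trig_poly_zero_far_from_max]). If [T 0 = 1] is the maximum and
[s] is a zero with [0 < s < pi / (2 * n)], compare [lam * T] with a cosine wave
[cos (n * (t - tau))] whose crest [tau] is slightly to the left of [0], with
[lam] slightly less than [1]. Among the [2 * n] points where the wave is [1] or
[-1] the difference alternates in sign, and the points [0] and [s] insert two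
more sign changes after the first of them. So the difference has at least
[2 * n + 1] zeros in one period, which is impossible: the substitution
[x = tan (t / 2)] turns a trigonometric polynomial of degree [n] into an
algebraic one of degree at most [2 * n].

On the sphere, call band of half-width [h] the set of the [u] whose angle with
a unit vector [m] differs by at most [h] from a number [theta]. Suppose that
[n] bands with the same half-width [eps] and with data [(m_j, phi_j)] cover the
sphere. Let [p] be a maximum point of the absolute value of
[P x = \prod_j (dotv m_j x - cos phi_j)]; it is not a zero because finitely
many hyperplanes do not cover the sphere ([sphere_avoids_hyperplanes]). Some
band, with number [j], contains [p]. Along the great circle through [m_j] and
[p], parametrized by the angle with [m_j], [P] is a trigonometric polynomial of
degree [n], its maximum is at the angle of [p], and it vanishes at [phi_j],
which is at distance at most [eps]. Hence [pi / 2 <= n * eps]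
([equal_bands_cover]).

Bands of unequal half-widths [h_i] are cut into bands of half-width [eps]; this
costs at most [eps] per band, and [eps] tends to zero ([finite_bands_cover]).
Finally a spherical segment is contained in a band of the same width, and an
arbitrary cover is reduced to a finite one by compactness, after widening all
the bands by a common factor [1 + r] with [r] small. A common factor is what
makes this work for a set of segments of any cardinality: it changes the sum of
the widths by a controlled amount. *)

Set Implicit Arguments.
Unset Strict Implicit.
Unset Printing Implicit Defensive.

Import Order.TTheory GRing.Theory Num.Theory.
Import numFieldNormedType.Exports.

Local Open Scope classical_set_scope.
Local Open Scope ring_scope.

(** * Counting zeros by sign changes *)

Section Alternation.
Variable R : realType.
Implicit Types (p : {poly R}).

Lemma poly_sign_change_root p (a b : R) :
  a < b -> p.[a] * p.[b] < 0 -> exists2 z, a < z < b & root p z.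
Proof.
move=> ltab ab_lt0.
have strict z : a <= z <= b -> root p z -> a < z < b.
  move=> /andP[az zb] /rootP pz0.
  rewrite !lt_neqAle az zb !andbT; apply/andP; split; apply/eqP => zE.
    by rewrite zE pz0 mul0r ltxx in ab_lt0.
  by rewrite -zE pz0 mulr0 ltxx in ab_lt0.
have [pa_le0|pa_gt0] := leP p.[a] 0.
  have pb_ge0 : 0 <= p.[b] by nra.
  have pab : p.[a] <= 0 <= p.[b] by rewrite pa_le0.
  have [z zab pz] := poly_ivt (ltW ltab) pab.
  by exists z; first exact: strict.
have pb_le0 : p.[b] <= 0 by nra.
have pab : (- p).[a] <= 0 <= (- p).[b].
  by rewrite !hornerN oppr_le0 oppr_ge0 ltW.
have [z zab] := poly_ivt (ltW ltab) pab; rewrite rootN => pz.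
by exists z; first exact: strict.
Qed.

(** Each of the [m] sign changes yields a root, and the roots are distinct
because they lie in consecutive open intervals. *)
Lemma alternation_lt_size p m (x : nat -> R) :
    (forall k, (k < m)%N -> x k < x k.+1) ->
    (forall k, (k <= m)%N -> 0 < (-1) ^+ k * p.[x k]) ->
  (m < size p)%N.
Proof.
move=> x_incr p_alt.
have /choice[z zP] k : exists z, (k < m)%N -> x k < z < x k.+1 /\ root p z.
  have [km|_] := boolP (k < m)%N; last by exists 0.
  have := mulr_gt0 (p_alt k (ltnW km)) (p_alt k.+1 km).
  rewrite mulrACA -exprD -signr_odd addnS addnn /= odd_double expr1.
  rewrite mulN1r oppr_gt0.
  by move=> /(poly_sign_change_root (x_incr k km))[z ? ?]; exists z.
have x_le k j : (k <= j)%N -> (j <= m)%N -> x k <= x j.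
  elim: j => [|j IHj]; first by rewrite leqn0 => /eqP ->.
  rewrite leq_eqVlt => /predU1P[->//|kj jm].
  by rewrite (le_trans (IHj _ (ltnW jm)))// ltW// x_incr.
have z_lt k j : (k < j)%N -> (j < m)%N -> z k < z j.
  move=> kj jm; have [/andP[_ zk] _] := zP k (ltn_trans kj jm).
  have [/andP[zj _] _] := zP j jm.
  by rewrite (lt_trans zk)// (le_lt_trans _ zj)// x_le// ltnW.
have := @max_poly_roots R p (mkseq z m); rewrite size_mkseq; apply.
- by apply/eqP => p0; move: (p_alt 0%N isT); rewrite p0 horner0 mulr0 ltxx.
- apply/allP => r /mapP[k]; rewrite mem_iota => /andP[_ km] ->.
  by case: (zP k km).
- rewrite map_inj_in_uniq ?iota_uniq// => k j.
  rewrite !mem_iota !add0n /= => km jm zkj.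
  by case: (ltngtP k j) => // [/z_lt/(_ jm)|/z_lt/(_ km)]; rewrite zkj ltxx.
Qed.

End Alternation.

(** * Trigonometric polynomials *)

Section TrigPoly.
Variable R : realType.

(** An inductive definition makes the two operations needed below, translation
and reflection of the variable, immediate, and a product of [n] affine
functions of [cos t] and [sin t], the form met on a great circle, is visibly in
degree [n]. *)
Inductive trig_poly : nat -> (R -> R) -> Prop :=
| trig_poly1 : trig_poly 0 (fun=> 1)
| trig_poly_affine a b c : trig_poly 1 (fun t => a * cos t + b * sin t + c)
| trig_polyM m n f g :
    trig_poly m f -> trig_poly n g -> trig_poly (m + n) (fun t => f t * g t)
| trig_poly_comb n a f g :
    trig_poly n f -> trig_poly n g -> trig_poly n (fun t => a * f t + g t).

Lemma trig_poly_shift n f u : trig_poly n f -> trig_poly n (fun t => f (t + u)).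
Proof.
elim=> [|a b c|{}n m {}f g _ If _ Ig|{}n a {}f g _ If _ Ig].
- exact: trig_poly1.
- rewrite (_ : (fun t => _) = fun t => (a * cos u + b * sin u) * cos t
    + (b * cos u - a * sin u) * sin t + c); first exact: trig_poly_affine.
  by apply/funext => t; rewrite cosD sinD; ring.
- exact: trig_polyM If Ig.
- exact: trig_poly_comb If Ig.
Qed.

Lemma trig_poly_reflect n f : trig_poly n f -> trig_poly n (fun t => f (- t)).
Proof.
elim=> [|a b c|{}n m {}f g _ If _ Ig|{}n a {}f g _ If _ Ig].
- exact: trig_poly1.
- rewrite (_ : (fun t => _) = fun t => a * cos t + (- b) * sin t + c).
    exact: trig_poly_affine.
  by apply/funext => t; rewrite cosN sinN; ring.
- exact: trig_polyM If Ig.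
- exact: trig_poly_comb If Ig.
Qed.

Lemma trig_poly_cosn_sinn n :
  trig_poly n (fun t => cos (n%:R * t)) /\ trig_poly n (fun t => sin (n%:R * t)).
Proof.
elim: n => [|n [Icos Isin]].
  split.
    rewrite (_ : (fun t => _) = fun=> 1); first exact: trig_poly1.
    by apply/funext => t; rewrite mul0r cos0.
  rewrite (_ : (fun t => _) = fun=> (-1) * 1 + 1).
    by apply: trig_poly_comb; exact: trig_poly1.
  by apply/funext => t; rewrite mul0r sin0; ring.
have cos1 := trig_poly_affine 1 0 0; have sin1 := trig_poly_affine 0 1 0.
rewrite -addn1; split.
  rewrite (_ : (fun t => _) = fun t =>
    (-1) * (sin (n%:R * t) * (0 * cos t + 1 * sin t + 0))
    + cos (n%:R * t) * (1 * cos t + 0 * sin t + 0)).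
    by apply: trig_poly_comb; apply: trig_polyM.
  by apply/funext => t; rewrite addn1 -natr1 mulrDl [1 * t]mul1r cosD; ring.
rewrite (_ : (fun t => _) = fun t =>
  1 * (sin (n%:R * t) * (1 * cos t + 0 * sin t + 0))
  + cos (n%:R * t) * (0 * cos t + 1 * sin t + 0)).
  by apply: trig_poly_comb; apply: trig_polyM.
by apply/funext => t; rewrite addn1 -natr1 mulrDl [1 * t]mul1r sinD; ring.
Qed.

(** With [x = tan (t / 2)], [cos t] and [sin t] are [cos (t / 2) ^+ 2] times
[1 - x ^+ 2] and [2 * x], and [1] is [cos (t / 2) ^+ 2] times [1 + x ^+ 2]:
every unit of trigonometric degree becomes a factor [cos (t / 2) ^+ 2] and two
units of degree in [x]. *)
Lemma trig_poly_half_angle n f : trig_poly n f ->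
  exists2 p : {poly R}, (size p <= n.*2.+1)%N &
    forall t, cos (t / 2) != 0 -> f t = cos (t / 2) ^+ n.*2 * p.[tan (t / 2)].
Proof.
elim=> [|a b c|{}n m {}f g _ [p sp pE] _ [q sq qE]|{}n a {}f g _ [p sp pE] _ [q sq qE]].
- by exists 1; rewrite ?size_polyC ?oner_eq0// => t _; rewrite hornerC mulr1.
- exists (Poly [:: a + c; 2 * b; c - a]); first exact: size_Poly.
  move=> t ct; have tE : t = t / 2 + t / 2 by rewrite -splitr.
  rewrite {1 2}tE cosD sinD horner_Poly /tan /=.
  have := cos2Dsin2 (t / 2); set C := cos _ in ct *; set S := sin _ => CS.
  apply/eqP; rewrite -subr_eq0.
  rewrite (_ : _ - _ = c * (1 - (C ^+ 2 + S ^+ 2))); last by field.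
  by rewrite CS subrr mulr0.
- exists (p * q).
    rewrite (leq_trans (size_polyMleq _ _))// doubleD.
    by rewrite -subn1 leq_subLR (leq_trans (leq_add sp sq))// addSn addnS add1n.
  by move=> t ct; rewrite pE// qE// hornerM doubleD exprD; ring.
- exists (a *: p + q).
    rewrite (leq_trans (size_polyD _ _))// geq_max sq andbT.
    by rewrite (leq_trans (size_scale_leq _ _)).
  by move=> t ct; rewrite pE// qE// hornerD hornerZ; ring.
Qed.

(** The points must lie in an open period, on which [tan (t / 2)] is increasing
and [cos (t / 2)] is positive, so that both the order of the points and the
signs pass to the polynomial in [x]. *)
Lemma trig_poly_alternation n f (y : nat -> R) m :
    trig_poly n f ->
    (forall k, (k <= m)%N -> - pi < y k < pi) ->
    (forall k, (k < m)%N -> y k < y k.+1) ->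
    (forall k, (k <= m)%N -> 0 < (-1) ^+ k * f (y k)) ->
  (m <= n.*2)%N.
Proof.
move=> /trig_poly_half_angle[p sp pE] y_bd y_incr f_alt.
have half k : (k <= m)%N -> y k / 2 \in `](- (pi / 2)), (pi / 2)[%R.
  by move=> /y_bd; rewrite in_itv/= => /andP[? ?]; apply/andP; split; lra.
have cos_gt0 k : (k <= m)%N -> 0 < cos (y k / 2).
  by move=> /half; rewrite in_itv/=; exact: cos_gt0_pihalf.
rewrite -ltnS (leq_trans _ sp)//.
apply: (@alternation_lt_size _ _ _ (fun k => tan (y k / 2))) => k km.
  by rewrite ltr_tan ?half// 1?ltnW// ltr_pM2r// y_incr.
have := f_alt k km; rewrite pE ?gt_eqF ?cos_gt0// mulrCA pmulr_rgt0//.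
by rewrite exprn_gt0 ?cos_gt0.
Qed.

End TrigPoly.

(** * Distance from a maximum to a zero *)

Section TrigMax.
Variable R : realType.

Lemma cos_natmul_pi k : cos (k%:R * pi) = (-1) ^+ k :> R.
Proof.
elim: k => [|k IHk]; first by rewrite mul0r cos0.
by rewrite -natr1 mulrDl mul1r cosDpi IHk exprS mulN1r.
Qed.

(** A comparison with a shifted cosine wave, by counting zeros. The wave is
shifted so that [0] comes just after its crest, where it lies below the value
[1] of [T], and [s] still lies before its first zero. *)
Lemma trig_poly_zero_right_of_max n (T : R -> R) s :
    trig_poly n T -> (0 < n)%N -> (forall t, `|T t| <= 1) -> T 0 = 1 ->
    T s = 0 -> 0 < s ->
  pi / 2 <= n%:R * s.
Proof.
move=> tpT n_gt0 T_le1 T0 Ts s_gt0; rewrite leNgt; apply/negP => ns.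
have pi_gt0 : 0 < pi :> R := pi_gt0 R.
have N_gt0 : 0 < n%:R :> R by rewrite ltr0n.
(* [h] is a quarter of the period of the wave: crest to zero. *)
pose h : R := pi / 2 / n%:R.
have nh : n%:R * h = pi / 2 by rewrite /h mulrC divfK ?gt_eqF.
have h_gt0 : 0 < h by rewrite /h !divr_gt0.
have s_lth : s < h by rewrite -(ltr_pM2l N_gt0) nh.
have h_le : h <= pi / 2.
  by rewrite -nh -[leLHS]mul1r ler_pM2r// ler1n.
pose eta : R := (h - s) / 2.
have eta_gt0 : 0 < eta by rewrite /eta; lra.
have eta_lt : eta + s < h by rewrite /eta; lra.
have cos_eta_lt1 : cos (n%:R * eta) < 1.
  have neta_gt0 : 0 < n%:R * eta by exact: mulr_gt0.
  have neta_le : n%:R * eta <= pi.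
    by rewrite (@le_trans _ _ (n%:R * h))// ?ler_pM2l// ?nh; lra.
  by rewrite -[ltRHS]cos0 ltr_cos ?in_itv/= ?lexx ?pi_ge0 ?(ltW neta_gt0) ?neta_le.
pose lam : R := (1 + cos (n%:R * eta)) / 2.
have cos_eta_gt0 : 0 < cos (n%:R * eta).
  apply: cos_gt0_pihalf; rewrite -nh -mulrN !ltr_pM2l//.
  by apply/andP; split; lra.
have lam01 : 0 < lam < 1 by rewrite /lam; apply/andP; split; lra.
(* The whole chain of points has to fit in the open period from [- pi] to [pi],
   so the maximum point [0] is moved to [h - pi]; the crest [tau] is a little
   to its left. *)
pose tau : R := h - pi - eta.
pose f t := (- lam) * T (t + (pi - h)) + cos (n%:R * (t - tau)).
have tpf : trig_poly n f.
  apply: trig_poly_comb; first exact: trig_poly_shift.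
  exact: (trig_poly_shift _ (proj1 (trig_poly_cosn_sinn R n))).
(* The extrema [tau + 2 * h * k] of the wave with [k < 2 * n], and between the
   first two of them the maximum and the zero of [T]. *)
pose y k : R := match k with
  | 0 => tau
  | 1 => tau + eta
  | 2 => tau + eta + s
  | k'.+3 => tau + (2 * h) * k'.+1%:R end.
suff : (n.*2.+1 <= n.*2)%N by rewrite ltnn.
have lamT t : - 1 < (- lam) * T t < 1.
  move: (T_le1 t) lam01; rewrite ler_norml => /andP[? ?] /andP[? ?].
  by apply/andP; split; nra.
apply: (@trig_poly_alternation _ _ f y) => //.
- move=> [|[|[|k]]] km /=; rewrite /tau.
  + by apply/andP; split; lra.
  + by apply/andP; split; lra.
  + by apply/andP; split; lra.
  + have kge0 : 0 <= h * k.+1%:R by rewrite mulr_ge0// ltW.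
    have : h * (k.+1%:R + 1) <= h * (2 * n%:R).
      by rewrite ler_pM2l// natr1 -natrM mul2n ler_nat; exact: km.
    rewrite mulrDr mulr1 mulrCA [h * n%:R]mulrC nh => hk.
    by rewrite -mulrA; apply/andP; split; lra.
- move=> [|[|[|k]]] km /=.
  + lra.
  + lra.
  + lra.
  + have lt_k : (k.+1%:R : R) < k.+2%:R by rewrite ltr_nat.
    by rewrite ltrD2l ltr_pM2l// mulr_gt0.
- move=> [|[|[|k]]] km /=; rewrite /f.
  + by rewrite subrr mulr0 cos0 expr0 mul1r; case/andP: (lamT (tau + (pi - h))); lra.
  + rewrite (_ : tau + eta + (pi - h) = 0); last by rewrite /tau; ring.
    rewrite (_ : tau + eta - tau = eta); last by ring.
    by rewrite expr1 T0 /lam; lra.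
  + rewrite (_ : tau + eta + s + (pi - h) = s); last by rewrite /tau; ring.
    rewrite (_ : tau + eta + s - tau = eta + s); last by ring.
    rewrite Ts mulr0 add0r sqrrN expr1n mul1r.
    apply: cos_gt0_pihalf; rewrite -nh -mulrN !ltr_pM2l//.
    by apply/andP; split; lra.
  + rewrite (_ : n%:R * (_ - tau) = k.+1%:R * pi); last first.
      rewrite (_ : tau + _ - tau = 2 * h * k.+1%:R); last by ring.
      by rewrite mulrA [_ * (2 * h)]mulrCA nh; field.
    rewrite cos_natmul_pi mulrDr -exprD -[in X in _ + X]signr_odd addSn addSn addnn.
    rewrite /= ?negbK odd_double expr0.
    have := lamT (tau + 2 * h * k.+1%:R + (pi - h)).
    set z := - lam * _ => /andP[z1 z2].
    by rewrite -signr_odd; case: odd; rewrite /= ?expr1 ?expr0; lra.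
Qed.

(** This follows from the case of a zero on the right of a maximum with value
[1] at [0], by translation, reflection and normalization. *)
Lemma trig_poly_zero_far_from_max n (T : R -> R) a s :
    trig_poly n T -> (0 < n)%N -> (forall t, `|T t| <= `|T a|) -> T a != 0 ->
    T s = 0 ->
  pi / 2 <= n%:R * `|s - a|.
Proof.
move=> tpT n_gt0 T_max Ta Ts.
have tp0 : trig_poly n (fun=> 0 : R).
  rewrite (_ : (fun=> _) = fun t => (-1) * T t + T t).
    exact: trig_poly_comb.
  by apply/funext => t; ring.
pose U t := (T a)^-1 * T (t + a) + 0.
have tpU : trig_poly n U by apply: trig_poly_comb; first exact: trig_poly_shift.
have U_le1 t : `|U t| <= 1.
  by rewrite /U addr0 normrM normfV mulrC ler_pdivrMr ?normr_gt0// mul1r.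
have U0 : U 0 = 1 by rewrite /U addr0 add0r mulVf.
have Us : U (s - a) = 0 by rewrite /U addr0 subrK Ts mulr0.
have [sa|sa|sa] := ltgtP a s.
- rewrite gtr0_norm ?subr_gt0//.
  by apply: (trig_poly_zero_right_of_max tpU); rewrite ?subr_gt0.
- rewrite ltr0_norm ?subr_lt0//.
  apply: (trig_poly_zero_right_of_max (trig_poly_reflect tpU));
    by rewrite ?oppr0 ?opprK ?oppr_gt0 ?subr_lt0.
- by rewrite sa Ts eqxx in Ta.
Qed.
End TrigMax.

(** * Euclidean and spherical geometry *)

Section DotProduct.
Variables (R : realType) (d : nat).
Implicit Types (u v w : 'rV[R]_d) (a : R).

Lemma dotvC u v : dotv u v = dotv v u.
Proof. by apply: eq_bigr => i _; rewrite mulrC. Qed.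

Lemma dotvDr u v w : dotv u (v + w) = dotv u v + dotv u w.
Proof. by rewrite -big_split; apply: eq_bigr => i _; rewrite mxE mulrDr. Qed.

Lemma dotvZr a u v : dotv u (a *: v) = a * dotv u v.
Proof. by rewrite /dotv mulr_sumr; apply: eq_bigr => i _; rewrite mxE mulrCA. Qed.

Lemma dotvDl u v w : dotv (u + v) w = dotv u w + dotv v w.
Proof. by rewrite dotvC dotvDr !(dotvC w). Qed.

Lemma dotvZl a u v : dotv (a *: u) v = a * dotv u v.
Proof. by rewrite dotvC dotvZr dotvC. Qed.

Definition dotvE := (dotvDl, dotvDr, dotvZl, dotvZr).

Lemma dotvv_ge0 u : 0 <= dotv u u.
Proof. by apply: sumr_ge0 => i _; rewrite -expr2 sqr_ge0. Qed.

Lemma dotvv_eq0 u : (dotv u u == 0) = (u == 0).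
Proof.
apply/idP/eqP => [|->]; last first.
  by apply/eqP/big1 => i _; rewrite mxE mul0r.
rewrite psumr_eq0 => [/allP u0|i _]; last by rewrite -expr2 sqr_ge0.
apply/rowP => i; rewrite mxE; apply/eqP.
by have := u0 i (mem_index_enum i); rewrite mulf_eq0 orbb.
Qed.

Lemma dotv_CauchySchwarz u v : dotv u v ^+ 2 <= dotv u u * dotv v v.
Proof.
have [v0|v_neq0] := eqVneq v 0.
  have zero0 w : dotv w 0 = 0 by rewrite -(scale0r (0 : 'rV[R]_d)) dotvZr mul0r.
  by rewrite v0 !zero0 expr0n mulr0.
have vv_gt0 : 0 < dotv v v by rewrite lt_neqAle eq_sym dotvv_eq0 v_neq0 dotvv_ge0.
have := dotvv_ge0 (dotv v v *: u + (- dotv u v) *: v).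
rewrite !dotvE (dotvC v u) => ge0.
rewrite -subr_ge0 -(pmulr_rge0 _ vv_gt0).
by apply: le_trans ge0 _; rewrite le_eqVlt; apply/orP; left; apply/eqP; ring.
Qed.

Lemma unit_sphereE u : unit_sphere R d u <-> dotv u u = 1.
Proof.
rewrite /unit_sphere /euclidean_norm /=; split => [uu|->]; last exact: sqrtr1.
by rewrite -(sqr_sqrtr (dotvv_ge0 u)) uu expr1n.
Qed.

Lemma dotv_unit_bound u v :
  unit_sphere R d u -> unit_sphere R d v -> -1 <= dotv u v <= 1.
Proof.
move=> /unit_sphereE u1 /unit_sphereE v1.
rewrite -ler_norml -(@ler_pXn2r _ 2) ?nnegrE// expr1n real_normK ?num_real//.
by rewrite (le_trans (dotv_CauchySchwarz u v))// u1 v1 mulr1.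
Qed.

Lemma unit_normalize u : u != 0 ->
  unit_sphere R d ((euclidean_norm u)^-1 *: u).
Proof.
rewrite -dotvv_eq0 => u0; apply/unit_sphereE; rewrite !dotvE mulrA -invfM.
by rewrite -expr2 sqr_sqrtr ?dotvv_ge0// mulVf.
Qed.

Lemma unit_comb u v (t : R) : unit_sphere R d u -> unit_sphere R d v ->
  dotv u v = 0 -> unit_sphere R d (cos t *: u + sin t *: v).
Proof.
move=> /unit_sphereE u1 /unit_sphereE v1 uv; apply/unit_sphereE.
by rewrite !dotvE (dotvC v u) uv u1 v1 -[RHS](cos2Dsin2 t); ring.
Qed.

(** When the sum of the two angles [a] and [b] is less than [pi], the claim is
[cos (a + b) <= dotv u w]. The components of [u] and [w] orthogonal to [v] have
lengths [sin a] and [sin b], and their inner product is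
[dotv u w - cos a * cos b], so this is the Cauchy-Schwarz inequality. *)
Lemma angular_dist_triangle u v w : unit_sphere R d u -> unit_sphere R d v ->
    unit_sphere R d w ->
  angular_dist u w <= angular_dist u v + angular_dist v w.
Proof.
move=> Su Sv Sw; rewrite /angular_dist.
have uv := dotv_unit_bound Su Sv; have vw := dotv_unit_bound Sv Sw.
have uw := dotv_unit_bound Su Sw.
have [/andP[uv0 uvpi] cuv] := acos_def uv.
have [/andP[vw0 vwpi] cvw] := acos_def vw.
have [/andP[uw0 uwpi] cuw] := acos_def uw.
set a := acos (dotv u v) in uv0 uvpi cuv *.
set b := acos (dotv v w) in vw0 vwpi cvw *.
set c := acos (dotv u w) in uw0 uwpi cuw *.
have [|ab_lt] := leP pi (a + b); first exact: le_trans.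
rewrite leNgt -ltr_cos ?in_itv/= ?uw0 ?uwpi ?addr_ge0 ?(ltW ab_lt)// -leNgt.
rewrite cosD cuw cuv cvw.
have sa := sin_ge0_pi (introT andP (conj uv0 uvpi)).
have sb := sin_ge0_pi (introT andP (conj vw0 vwpi)).
pose u' := u + (- dotv u v) *: v; pose w' := w + (- dotv v w) *: v.
have := dotv_CauchySchwarz u' w'.
move: Su Sv Sw => /unit_sphereE u1 /unit_sphereE v1 /unit_sphereE w1.
have -> : dotv u' u' = sin a ^+ 2.
  by rewrite sin2cos2 cuv !dotvE u1 v1 (dotvC v u); ring.
have -> : dotv w' w' = sin b ^+ 2.
  by rewrite sin2cos2 cvw !dotvE w1 v1 (dotvC w v); ring.
have -> : dotv u' w' = dotv u w - dotv u v * dotv v w.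
  by rewrite !dotvE v1; ring.
rewrite -exprMn -real_normK ?num_real// ler_pXn2r ?nnegrE ?mulr_ge0//.
by rewrite ler_norml => /andP[+ _]; lra.
Qed.

Lemma angular_distC u v : angular_dist u v = angular_dist v u.
Proof. by rewrite /angular_dist dotvC. Qed.

Lemma angular_dist_diff u v w : unit_sphere R d u -> unit_sphere R d v ->
    unit_sphere R d w ->
  `|angular_dist u v - angular_dist u w| <= angular_dist v w.
Proof.
move=> Su Sv Sw; rewrite ler_distl.
have uw := angular_dist_triangle Su Sv Sw.
have := angular_dist_triangle Su Sw Sv; rewrite (angular_distC w v) => uv.
by apply/andP; split; lra.
Qed.

End DotProduct.

Section Avoidance.
Variables (R : realType) (d : nat).
Hypothesis d_ge2 : (2 <= d)%N.
Implicit Types (L : seq ('rV[R]_d * R)).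

(** A rational curve on the sphere escapes: the reflections [u x] of the first
basis vector [e0] in the hyperplanes orthogonal to [w x], where [w x] has the
coordinates [x ^+ i]. Up to the positive factor [dotv (w x) (w x)], being on
the hyperplane [(n, c)] is a polynomial equation in [x]. Its coefficient of
highest degree, [2 * (d - 1)], is [n 0 0 - c]; if this vanishes what is left is
a multiple of the polynomial with the coordinates of [n] as coefficients. So
the equation is not trivial, and finitely many of them have finitely many
solutions. *)
Lemma sphere_avoids_hyperplanes L : (forall H, H \in L -> H.1 != 0) ->
  exists2 u, unit_sphere R d u & forall H, H \in L -> dotv H.1 u != H.2.
Proof.
case: d d_ge2 L => [|[|k]]// _ L Lneq0.
pose e0 : 'rV[R]_k.+2 := delta_mx 0 0.
pose w x : 'rV[R]_k.+2 := \row_i x ^+ i.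
have e0E u : dotv e0 u = u 0 0.
  rewrite /dotv (bigD1 ord0)//= big1 => [|i i0]; last first.
    by rewrite mxE (negbTE i0) andbF mul0r.
  by rewrite mxE !eqxx mul1r addr0.
have ww_gt0 x : 0 < dotv (w x) (w x).
  rewrite lt_neqAle eq_sym dotvv_eq0 dotvv_ge0 andbT.
  by apply/eqP => /rowP/(_ ord0)/eqP; rewrite !mxE expr0 oner_eq0.
pose u x := e0 + (- (2 / dotv (w x) (w x))) *: w x.
have Su x : unit_sphere R k.+2 (u x).
  apply/unit_sphereE; rewrite /u !dotvE (dotvC (w x) e0) !e0E !mxE expr0 !eqxx /=.
  by field; rewrite gt_eqF.
pose W : {poly R} := \sum_(i < k.+2) 'X^(i.*2).
have WE x : W.[x] = dotv (w x) (w x).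
  rewrite horner_sum; apply: eq_bigr => i _.
  by rewrite hornerXn !mxE -exprD addnn.
pose P (H : 'rV[R]_k.+2 * R) := (H.1 0 0 - H.2) *: W - 2 *: rVpoly H.1.
have PE H x : (P H).[x] = dotv (w x) (w x) * (dotv H.1 (u x) - H.2).
  have nE : (rVpoly H.1).[x] = dotv H.1 (w x).
    rewrite (@horner_coef_wide _ k.+2) ?size_poly//; apply: eq_bigr => i _.
    by rewrite coef_rVpoly_ord mxE.
  rewrite /P hornerD hornerN !hornerZ WE nE /u !dotvE (dotvC _ e0) e0E.
  by field; rewrite gt_eqF.
have P_neq0 H : H \in L -> P H != 0.
  move=> HL; apply/eqP => P0.
  have /eqP c0 : H.1 0 0 - H.2 == 0.
    have /eqP := congr1 (fun p : {poly R} => p`_(k.+1.*2)) P0.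
    rewrite coefB !coefZ coef0 coef_sum big_ord_recr /= coefXn eqxx.
    rewrite big1 => [|i _]; last first.
      by rewrite coefXn (inj_eq double_inj) gtn_eqF.
    rewrite add0r mulr1 nth_default ?mulr0 ?subr0//.
    by rewrite (leq_trans (size_poly _ _))// doubleS !ltnS -addnn leq_addr.
  move: P0; rewrite /P c0 scale0r add0r => /eqP.
  rewrite oppr_eq0 scaler_eq0 pnatr_eq0 /= => /eqP n0.
  by have := Lneq0 H HL; rewrite -(rVpolyK H.1) n0 linear0 eqxx.
pose Q := \prod_(H <- L) P H.
have Q_neq0 : Q != 0 by rewrite prodf_seq_neq0; apply/allP => H HL; rewrite P_neq0.
have [x Qx] : exists x, Q.[x] != 0.
  apply/not_existsP => Q0.
  have := @max_poly_roots _ Q (mkseq (fun i => i%:R) (size Q)) Q_neq0.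
  rewrite size_mkseq ltnn => absurd; suff: false by []; apply: absurd.
    by apply/allP => r _; rewrite /root; apply: contra_notT (Q0 r).
  by rewrite mkseq_uniq// => i j /eqP; rewrite eqr_nat => /eqP.
exists (u x) => // H HL.
apply: contraNneq Qx => HE; rewrite horner_prod prodf_seq_eq0.
by apply/hasP; exists H; rewrite //= PE HE subrr mulr0.
Qed.

End Avoidance.

(** * Bands of equal width *)

Section EqualBands.
Variables (R : realType) (d : nat).

Lemma continuous_dotv (f g : 'rV[R]_d -> 'rV[R]_d) :
  continuous f -> continuous g -> continuous (fun x => dotv (f x) (g x)).
Proof.
move=> cf cg; apply: continuous_big => [x|i _ x]; first exact: add_continuous.
have ci : continuous (fun v : 'rV[R]_d => v 0 i) by exact: coord_continuous.
exact: cvgM (continuous_comp (cf x) (ci (f x))) (continuous_comp (cg x) (ci (g x))).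
Qed.

Lemma compact_unit_sphere : compact (unit_sphere R d).
Proof.
have sphereE : unit_sphere R d = (fun u => dotv u u) @^-1` [set 1].
  by apply/seteqP; split => u /unit_sphereE.
pose box := [set v : 'rV[R]_d | forall i, `[-1, 1]%classic (v ord0 i)].
refine (@subclosed_compact _ _ box _ _ _).
- rewrite sphereE; apply: closed_comp; last exact: closed_eq.
  by move=> x _; apply: continuous_dotv => y; exact: cvg_id.
- apply: (@rV_compact R d (fun=> `[-1, 1]%classic)) => i; exact: segment_compact.
- move=> u /unit_sphereE u1 i /=.
  rewrite in_itv/= -ler_norml -(@ler_pXn2r _ 2) ?nnegrE// expr1n real_normK ?num_real//.
  rewrite -u1 /dotv (bigD1 i)//= -expr2 lerDl.
  by apply: sumr_ge0 => j _; rewrite -expr2 sqr_ge0.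
Qed.

Hypothesis d_ge2 : (2 <= d)%N.
Implicit Types (L : seq ('rV[R]_d * R)).

(** When [p] is [m] or [- m], any unit vector orthogonal to [m] is a valid
direction [q]; there is one because the hyperplanes [(m, 1)] and [(m, -1)] do
not cover the sphere. *)
Lemma great_circle_through (m p : 'rV[R]_d) :
    unit_sphere R d m -> unit_sphere R d p ->
  exists q, [/\ unit_sphere R d q, dotv m q = 0 &
    p = cos (angular_dist m p) *: m + sin (angular_dist m p) *: q].
Proof.
move=> Sm Sp; have mm : dotv m m = 1 by exact/unit_sphereE.
have m_neq0 : m != 0 by rewrite -dotvv_eq0 mm oner_eq0.
have orth u : unit_sphere R d u ->
    dotv (u + (- dotv m u) *: m) (u + (- dotv m u) *: m) = 1 - dotv m u ^+ 2.
  by move=> /unit_sphereE u1; rewrite !dotvE mm u1 (dotvC u m); ring.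
have orth_m u : dotv m (u + (- dotv m u) *: m) = 0 by rewrite !dotvE mm; ring.
have mp := dotv_unit_bound Sm Sp.
have cE : cos (angular_dist m p) = dotv m p by rewrite acosK// in_itv.
have sE : sin (angular_dist m p) ^+ 2 = 1 - dotv m p ^+ 2 by rewrite sin2cos2 cE.
rewrite cE; set s := sin _ in sE *.
have [s0|s_neq0] := eqVneq s 0; last first.
  exists (s^-1 *: (p + (- dotv m p) *: m)); split.
  - apply/unit_sphereE; rewrite dotvZl dotvZr orth// -sE.
    by field.
  - by rewrite dotvZr orth_m mulr0.
  - by rewrite scalerA divff// scale1r scaleNr addrC subrK.
have [|u Su u_neq] := @sphere_avoids_hyperplanes R d d_ge2 [:: (m, 1); (m, -1)].
  by move=> H; rewrite !inE => /orP[]/eqP ->.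
have u1 : dotv m u != 1 by apply: (u_neq (m, 1)); rewrite inE eqxx.
have uN1 : dotv m u != -1 by apply: (u_neq (m, -1)); rewrite !inE eqxx orbT.
have v_neq0 : u + (- dotv m u) *: m != 0.
  rewrite -dotvv_eq0 orth// subr_eq0 eq_sym -(expr1n _ 2) eqf_sqr.
  by rewrite (negbTE u1) (negbTE uN1).
exists ((euclidean_norm (u + (- dotv m u) *: m))^-1 *: (u + (- dotv m u) *: m)).
split; [exact: unit_normalize | by rewrite dotvZr orth_m mulr0 |].
rewrite s0 scale0r addr0; apply/eqP; rewrite -subr_eq0 -scaleNr -dotvv_eq0.
by rewrite orth// -sE s0 expr0n.
Qed.

Lemma trig_poly_on_circle L (m q : 'rV[R]_d) :
  trig_poly (size L)
    (fun t => \prod_(H <- L) (dotv H.1 (cos t *: m + sin t *: q) - cos H.2)).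
Proof.
elim: L => [|H L IHL].
  rewrite (_ : (fun t => _) = fun=> 1); first exact: trig_poly1.
  by apply/funext => t; rewrite big_nil.
rewrite (_ : (fun t => _) = fun t =>
    (dotv H.1 m * cos t + dotv H.1 q * sin t + - cos H.2)
    * \prod_(H <- L) (dotv H.1 (cos t *: m + sin t *: q) - cos H.2)); last first.
  by apply/funext => t; rewrite big_cons !dotvE !(mulrC (dotv _ _)).
exact: trig_polyM (trig_poly_affine _ _ _) IHL.
Qed.

(** A pair [H] of [L] stands for the band of the points whose angle with [H.1]
is within [eps] of [H.2]. The number [H.2] may be negative or exceed [pi]: it
is used as a parameter on a great circle and not as the value of an angle, so
that bands that overrun a pole need no separate treatment. *)
Lemma equal_bands_cover L (eps : R) :
    (forall H, H \in L -> unit_sphere R d H.1) ->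
    (forall u, unit_sphere R d u ->
      exists2 H, H \in L & `|angular_dist H.1 u - H.2| <= eps) ->
  pi / 2 <= (size L)%:R * eps.
Proof.
move=> L_unit L_cover.
pose P x := \prod_(H <- L) (dotv H.1 x - cos H.2).
have L_neq0 H : H \in [seq (H.1, cos H.2) | H <- L] -> H.1 != 0.
  move=> /mapP[K KL ->] /=; rewrite -dotvv_eq0.
  by have /unit_sphereE -> := L_unit _ KL; rewrite oner_eq0.
have [e Se e_neq] := sphere_avoids_hyperplanes d_ge2 L_neq0.
have Pe : P e != 0.
  rewrite prodf_seq_neq0; apply/allP => H HL; rewrite subr_eq0.
  by apply: (e_neq (H.1, cos H.2)); apply: map_f.
have cP : continuous P.
  apply: continuous_big => [x|H _ x]; first exact: mul_continuous.
  have cH : continuous (dotv H.1).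
    apply: (@continuous_dotv (fun=> H.1) id); [exact: cst_continuous|].
    by move=> y; exact: cvg_id.
  exact: cvgB (cH x) (cvg_cst _).
have cPn : {within unit_sphere R d, continuous (fun x => `|P x|)}.
  by apply: continuous_subspaceT => x; exact: cvg_norm (cP x).
have [p /set_mem Sp p_max] :=
  EVT_max_rV (ex_intro _ e Se) compact_unit_sphere cPn.
have Pp : P p != 0.
  have := p_max e (mem_set Se); rewrite -!normr_gt0 in Pe *; exact: lt_le_trans.
have [H HL Hp] := L_cover p Sp.
have Sm := L_unit H HL.
have [q [Sq mq pE]] := great_circle_through Sm Sp.
set m := H.1 in Sm mq pE Hp; set a := angular_dist m p in pE Hp.
have mm : dotv m m = 1 by exact/unit_sphereE.
pose T t := P (cos t *: m + sin t *: q).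
have Ta : T a = P p by rewrite /T -pE.
apply: le_trans (_ : (size L)%:R * `|H.2 - a| <= _); last first.
  by rewrite distrC ler_wpM2l.
apply: (@trig_poly_zero_far_from_max _ _ T).
- exact: trig_poly_on_circle.
- by case: (L) HL.
- by move=> t; rewrite Ta; apply: p_max; apply: mem_set; exact: unit_comb.
- by rewrite Ta.
- apply/eqP; rewrite prodf_seq_eq0; apply/hasP; exists H => //=.
  by rewrite !dotvE -/m mm mq mulr1 mulr0 addr0 subrr.
Qed.

End EqualBands.

(** * Bands of arbitrary widths *)

Section Split.
Variable R : realType.

(** Consecutive intervals of length [2 * eps], starting at [theta - h]; the
last one may overrun [theta + h], which is the reason for the extra [eps]. *)
Lemma interval_split (theta h eps : R) : 0 <= h -> 0 < eps ->
  exists2 s : seq R, (size s)%:R * eps <= h + eps &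
    forall a, `|a - theta| <= h -> exists2 phi, phi \in s & `|a - phi| <= eps.
Proof.
move=> h_ge0 eps_gt0; pose k := (Num.truncn (h / eps)).+1.
have /andP[k_le k_gt] := truncn_itv (divr_ge0 h_ge0 (ltW eps_gt0)).
rewrite ler_pdivlMr// in k_le; rewrite ltr_pdivrMr// -/k in k_gt.
exists (mkseq (fun j => theta - h + eps * (2 * j%:R + 1)) k).
  by rewrite size_mkseq -natr1; lra.
move=> a; rewrite ler_distl => /andP[a_ge a_le].
have eps2 : 0 < 2 * eps by rewrite mulr_gt0.
have a_ge0 : 0 <= (a - theta + h) / (2 * eps) by rewrite divr_ge0 ?(ltW eps2)//; lra.
have := truncn_itv a_ge0; set j := Num.truncn _.
rewrite ler_pdivlMr// ltr_pdivrMr// -natr1 => /andP[j_le j_gt].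
exists (theta - h + eps * (2 * j%:R + 1)).
  apply/mapP; exists j => //; rewrite mem_iota add0n /= -(ltr_nat R) -(ltr_pM2r eps2).
  by lra.
by rewrite ler_distl; apply/andP; split; lra.
Qed.

End Split.

Section Bands.
Variables (R : realType) (d : nat).
Hypothesis d_ge2 : (2 <= d)%N.

Lemma bands_split (I : eqType) (s : seq I) (m : I -> 'rV[R]_d) (theta h : I -> R)
    (eps : R) :
    0 < eps -> (forall i, i \in s -> 0 <= h i) ->
  exists L : seq ('rV[R]_d * R),
    [/\ (size L)%:R * eps <= \sum_(i <- s) (h i + eps),
        forall H, H \in L -> exists2 i, i \in s & H.1 = m i &
        forall i a, i \in s -> `|a - theta i| <= h i ->
          exists2 phi, (m i, phi) \in L & `|a - phi| <= eps].
Proof.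
move=> eps_gt0; elim: s => [|i s IHs] h_ge0.
  by exists [::]; split => //; rewrite big_nil mul0r.
have [j js|L [sL mL coverL]] := IHs; first by rewrite h_ge0// inE js orbT.
have [t st cover_t] := interval_split (theta i) (h_ge0 i (mem_head i s)) eps_gt0.
exists ([seq (m i, phi) | phi <- t] ++ L); split.
- by rewrite size_cat size_map natrD mulrDl big_cons lerD.
- move=> H; rewrite mem_cat => /orP[/mapP[phi _ ->]|/mL[j js ->]].
    by exists i => //; exact: mem_head.
  by exists j => //; rewrite inE js orbT.
- move=> j a; rewrite inE => /predU1P[->|js] => [/cover_t|/(coverL _ _ js)].
    by case=> phi phi_t ?; exists phi; rewrite // mem_cat map_f.
  by case=> phi phi_L ?; exists phi; rewrite // mem_cat phi_L orbT.
Qed.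

(** Cutting all the bands into bands of half-width [eps] costs at most
[size s * eps] in the sum, and [eps] is arbitrary. *)
Lemma finite_bands_cover (I : eqType) (s : seq I) (m : I -> 'rV[R]_d)
    (theta h : I -> R) :
    (forall i, i \in s -> unit_sphere R d (m i)) ->
    (forall i, i \in s -> 0 <= h i) ->
    (forall u, unit_sphere R d u ->
      exists2 i, i \in s & `|angular_dist (m i) u - theta i| <= h i) ->
  pi / 2 <= \sum_(i <- s) h i.
Proof.
move=> m_unit h_ge0 s_cover; apply/ler_addgt0Pr => e e_gt0.
have N_gt0 : 0 < (size s).+1%:R :> R by rewrite ltr0n.
have eps_gt0 : 0 < e / (size s).+1%:R by exact: divr_gt0.
have [L [sL mL coverL]] := bands_split m theta eps_gt0 h_ge0.
have /le_trans : pi / 2 <= (size L)%:R * (e / (size s).+1%:R).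
  apply: (equal_bands_cover d_ge2) => [H /mL[i si ->]|u /s_cover[i si /(coverL _ _ si)]].
    exact: m_unit.
  by case=> phi phiL ?; exists (m i, phi).
apply; rewrite (le_trans sL)// big_split /= lerD2l big_const_seq count_predT iter_addr_0.
rewrite -[leLHS]mulr_natl mulrCA ler_piMr ?(ltW e_gt0)// ler_pdivrMr// mul1r.
by rewrite ler_nat.
Qed.

(** The hyperplane meets the sphere in points at a common angle [theta] from its
unit normal [m], and the angle with [m] is a 1-Lipschitz function. If the
hyperplane misses the sphere, the segment is empty and any [theta] is valid. *)
Lemma spherical_segment_band w (Z : set 'rV[R]_d) : spherical_segment w Z ->
  exists (m : 'rV[R]_d) (theta : R), [/\ unit_sphere R d m, 0 < w,
    Z `<=` unit_sphere R d &
    forall u, Z u -> `|angular_dist m u - theta| <= w / 2].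
Proof.
move=> [_ [delta [delta_gt0 -> [n [c [n_neq0 ->]]] ->]]].
have Sm := unit_normalize n_neq0.
set k := (euclidean_norm n)^-1 in Sm.
exists (k *: n), (acos (k * c)); split => //.
- by rewrite mulr_gt0.
- by move=> u [].
move=> u [Su u_near]; rewrite (_ : 2 * delta / 2 = delta); last by field.
rewrite leNgt; apply/negP => delta_lt.
have : (`|angular_dist (k *: n) u - acos (k * c)|%:E <= delta%:E)%E.
  apply: le_trans u_near; apply: le_ereal_inf_tmp => _ [v [/= nv Sv] <-].
  rewrite lee_fin -nv -dotvZl; exact: angular_dist_diff.
by rewrite lee_fin leNgt delta_lt.
Qed.

End Bands.

(** * Reduction to finitely many bands *)

Theorem corollary1p15 (R : realType) (d : nat) (hd : (2 <= d)%N)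
    (I : choiceType) (D : set I) (Z : I -> set 'rV[R]_d) (w : I -> R)
    (hZ : forall i, D i -> spherical_segment (w i) (Z i))
    (hcover : unit_sphere R d `<=` \bigcup_(i in D) Z i) :
  (pi%:E <= \esum_(i in D) (w i)%:E)%E.
Proof.
have /choice[b bP] i : exists b : 'rV[R]_d * R, D i ->
    [/\ unit_sphere R d b.1, 0 < w i, Z i `<=` unit_sphere R d &
    forall u, Z i u -> `|angular_dist b.1 u - b.2| <= w i / 2].
  have [Di|nDi] := pselect (D i); last by exists (0, 0).
  by have [m [theta ?]] := spherical_segment_band (hZ i Di); exists (m, theta).
have w_gt0 i : D i -> 0 < w i by case/bP.
have : (0 <= \esum_(i in D) (w i)%:E)%E.
  by apply: esum_ge0 => i Di; rewrite lee_fin ltW// w_gt0.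
case sumE : (\esum_(i in D) (w i)%:E)%E => [E| |]; [|by move=> _; rewrite leey|by []].
rewrite !lee_fin => E_ge0; apply/ler_addgt0Pr => e e_gt0.
have E1_gt0 : 0 < E + 1 by lra.
(* The bands are widened by the factor [1 + r], which adds at most [e]. *)
pose r : R := e / (E + 1).
have r_gt0 : 0 < r by exact: divr_gt0.
have rE : r * E <= e by rewrite /r mulrAC ler_pdivrMr// ler_pM2l//; lra.
(* The minimum with [pi] keeps [rho i] in the range where [cos] decreases. *)
pose rho i : R := Num.min (r * w i / 2) pi.
(* The [rho i]-neighbourhood of [Z i] on the sphere is the trace of a union of
   open half-spaces. *)
pose O i := \bigcup_(u in Z i) [set v | cos (rho i) < dotv u v].
have O_open i : D i -> open (O i).
  move=> Di; apply: bigcup_open => u Zu.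
  have cu : continuous (dotv u).
    apply: (@continuous_dotv _ _ (fun=> u) id); [exact: cst_continuous|].
    by move=> x; exact: cvg_id.
  apply: (@open_comp _ _ (dotv u) [set x | cos (rho i) < x]).
    by move=> x _; exact: cu.
  exact: open_gt.
have rho_itv i : D i -> 0 < rho i <= pi.
  move=> Di; rewrite /rho lt_min pi_gt0 andbT ge_min lexx orbT andbT.
  by rewrite divr_gt0// mulr_gt0// w_gt0.
have O_cover : unit_sphere R d `<=` cover D O.
  move=> u Su; have [i Di Zu] := hcover u Su; exists i => //; exists u => //=.
  have /andP[rho_gt0 rho_le] := rho_itv i Di.
  have /unit_sphereE -> := Su; rewrite -[ltRHS]cos0 ltr_cos ?in_itv/= ?lexx ?pi_ge0//.
  by rewrite (ltW rho_gt0).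
have := @compact_unit_sphere R d; rewrite compact_cover.
move=> /(_ _ D O O_open O_cover)[F FD F_cover].
have FDi i : i \in F -> D i by move=> /FD /set_mem.
have F_band u : unit_sphere R d u ->
    exists2 i, i \in F & `|angular_dist (b i).1 u - (b i).2| <= (1 + r) * w i / 2.
  move=> Su; have [i /= iF [v Zv /= vu]] := F_cover u Su; exists i => //.
  have Di : D i := FDi i iF.
  have [Sm _ ZS band] := bP i Di; have Sv := ZS v Zv.
  have /andP[rho_gt0 rho_le] := rho_itv i Di.
  have vu_le : angular_dist v u <= r * w i / 2.
    have [/andP[? ?] cvu] := acos_def (dotv_unit_bound Sv Su).
    apply: (@le_trans _ _ (rho i)); last by rewrite /rho ge_min lexx.
    rewrite ltW// -ltr_cos ?in_itv/= ?(ltW rho_gt0)//; last exact/andP.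
    by rewrite cvu.
  have := angular_dist_diff Sm Sv Su; have := band v Zv.
  rewrite !ler_distl => /andP[? ?] /andP[? ?]; apply/andP; split; lra.
have : pi / 2 <= \sum_(i <- F) (1 + r) * w i / 2.
  apply: (finite_bands_cover hd _ _ F_band) => i /FDi Di; first by case: (bP i Di).
  by rewrite divr_ge0// mulr_ge0//; [lra|rewrite ltW// w_gt0].
have F_le : \sum_(i <- F) w i <= E.
  rewrite -lee_fin -sumE -sumEFin; apply: esum_ge; exists [set` F].
    by split; [exact: finite_fset|move=> i /= /FDi].
  by rewrite -fsbig_seq// fset_uniq.
rewrite -mulr_suml -mulr_sumr => piF.
have : (1 + r) * (\sum_(i <- F) w i) <= (1 + r) * E by rewrite ler_pM2l//; lra.
lra.
Qed.
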